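(* Let $R$ be a unital ring with involution and let $a\in R$ be Moore-Penrose invertible with Moore-Penrose inverse $a^\dagger$. Then the following are equivalent: (1) $a$ is an EP element; (2) $aR=a^2R$ and $[a^\dagger a,a^\dagger]=0$; (3) $aR=a^2R$ and $[a^\dagger a,a]=0$; (4) $aR=a^2R$ and $aR\subseteq a^\dagger R$; (5) $aR=a^2R$ and $aR\subseteq a^*R$.
   Context: A unital (associative, not necessarily commutative) ring with involution is a unital ring $R$ with a map $a\mapsto a^*$ satisfying $(a^* )^*=a$, $(ab)^*=b^*a^*$, $(a+b)^*=a^*+b^*$ for all $a,b\in R$. Notation: $[a,b]=ab-ba$, $aR=\{ar:r\in R\}$. The Moore-Penrose inverse of $a\in R$ is the element $a^\dagger=x$ (unique if it exists) with $axa=a$, $xax=x$, $(ax)^*=ax$, $(xa)^*=xa$; the group inverse of $a$ is the element $a^\#=x$ (unique if it exists) with $axa=a$, $xax=x$, $ax=xa$. An element $a\in R$ is EP if it is both Moore-Penrose invertible and group invertible and $a^\dagger=a^\#$. *)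

(* Defs.v *)
From HB Require Import structures.
From mathcomp Require Import all_boot all_algebra.
From mathcomp Require Import classical_sets.

Set Implicit Arguments.
Unset Strict Implicit.
Unset Printing Implicit Defensive.

Import GRing.Theory.
Local Open Scope ring_scope.
Local Open Scope classical_set_scope.

(* Rings are [pzRingType]: unital, associative, possibly noncommutative and
   possibly trivial (1 = 0 is allowed). *)

Record ring_involution (R : pzRingType) (star : R -> R) : Prop :=
  RingInvolution {
    ring_involutionK : forall a, star (star a) = a;
    ring_involutionM : forall a b, star (a * b) = star b * star a;
    ring_involutionD : forall a b, star (a + b) = star a + star b }.

Definition ring_commutator (R : pzRingType) (a b : R) : R := a * b - b * a.

Definition right_ideal (R : pzRingType) (a : R) : set R :=
  [set a * r | r in [set: R]].

Definition is_MP_inverse (R : pzRingType) (star : R -> R) (a x : R) : Prop :=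
  [/\ a * x * a = a, x * a * x = x, star (a * x) = a * x
    & star (x * a) = x * a].

Definition is_group_inverse (R : pzRingType) (a x : R) : Prop :=
  [/\ a * x * a = a, x * a * x = x & a * x = x * a].

Definition is_EP (R : pzRingType) (star : R -> R) (a : R) : Prop :=
  exists adag asharp : R,
    [/\ is_MP_inverse star a adag, is_group_inverse a asharp & adag = asharp].

(* Main.v *)
Require Import Defs.
From HB Require Import structures.
From mathcomp Require Import all_boot all_algebra.
From mathcomp Require Import classical_sets.

(** Write [p = adag * a] and [q = a * adag] for the two projections attached to
    the Moore-Penrose inverse; they generate the right ideals
    [p R = adag R = a^* R] and [q R = a R].  By uniqueness of the Moore-Penrose
    inverse, [a] is EP exactly when [p = q].

    The second halves of conditions (2)-(5) all say [p * a = a], that is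
    [q R <= p R].  For the two inclusions this is the description of [p R]
    above; for the commutator with [a] it is immediate from [a * p = a]; the
    commutator with [adag] says [q * p = q], which the involution turns into
    [p * q = q] ([commutator_MP_proj_adag]).

    The condition [a R = a^2 R] gives the opposite inclusion: if [a = a^2 r]
    and [p * a = a], then [p = adag * a^2 * r = a * r] lies in [a R = q R].  Two
    self-adjoint idempotents generating the same right ideal are equal, so
    [p = q] ([commute_MP_inverseP]). *)

Set Implicit Arguments.
Unset Strict Implicit.
Unset Printing Implicit Defensive.

Import GRing.Theory.
Local Open Scope ring_scope.
Local Open Scope classical_set_scope.

Section RightIdeal.

Variable R : pzRingType.
Implicit Types a b : R.

Lemma sub_right_idealP a b :
  right_ideal a `<=` right_ideal b <-> exists r, a = b * r.
Proof.
split=> [sub_ab | [r ->] _ [s _ <-]]; last by exists (r * s); rewrite ?mulrA.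
have [|r _ <-] := sub_ab a; first by exists 1; rewrite ?mulr1.
by exists r.
Qed.

Lemma right_ideal_sqrP a :
  right_ideal a = right_ideal (a ^+ 2) <-> exists r, a = a * a * r.
Proof.
rewrite -expr2 -sub_right_idealP; split=> [<- //|sub_aa2].
by apply/seteqP; split=> // _ [s _ <-]; exists (a * s); rewrite // expr2 mulrA.
Qed.

End RightIdeal.

Section MoorePenrose.

Variables (R : pzRingType) (star : R -> R).
Hypothesis star_inv : ring_involution star.

Let starK := ring_involutionK star_inv.
Let starM := ring_involutionM star_inv.

(** Two self-adjoint idempotents with the same range coincide; this is applied
    to the range projections [a * x] and [a * y], and dually to [x * a] and
    [y * a]. *)
Lemma MP_inverse_unique (a x y : R) :
  is_MP_inverse star a x -> is_MP_inverse star a y -> x = y.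
Proof.
case=> axa xax ax_sa xa_sa [aya yay ay_sa ya_sa].
have ax_ay : a * x = a * y.
  by rewrite -{1}aya -(mulrA (a * y)) -{1}ay_sa -ax_sa -starM mulrA axa.
have xa_ya : x * a = y * a.
  by rewrite -{1}aya -mulrA mulrA -{1}xa_sa -ya_sa -starM -mulrA (mulrA a) axa.
by rewrite -xax -mulrA ax_ay mulrA xa_ya yay.
Qed.

Variables a adag : R.
Hypothesis a_MP : is_MP_inverse star a adag.

Let mpK : a * adag * a = a. Proof. by case: a_MP. Qed.
Let mpVK : adag * a * adag = adag. Proof. by case: a_MP. Qed.
Let q_sa : star (a * adag) = a * adag. Proof. by case: a_MP. Qed.
Let p_sa : star (adag * a) = adag * a. Proof. by case: a_MP. Qed.

Lemma is_EP_commuteP : is_EP star a <-> a * adag = adag * a.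
Proof.
split=> [[x [y [x_MP [_ _ xC] xy]]] | comm_a].
  by rewrite (MP_inverse_unique a_MP x_MP) xy.
by exists adag, adag.
Qed.

(** Under [p * a = a] the projections satisfy [q R <= p R], and a factorization
    [a = a^2 r] is what puts [p] into [q R]; without it [p] and [q] could
    differ. *)
Lemma commute_MP_inverseP :
  a * adag = adag * a <->
  right_ideal a = right_ideal (a ^+ 2) /\ adag * a * a = a.
Proof.
rewrite right_ideal_sqrP; split=> [comm_a | [[r a_a2r] pa]].
  split; last by rewrite -comm_a mpK.
  by exists adag; rewrite -mulrA comm_a mulrA mpK.
have p_ar : adag * a = a * r by rewrite {1}a_a2r !mulrA pa.
(* The inclusions [p R <= q R] and [q R <= p R]; the adjoint of the second is
   [q * p = q], to be compared with the first. *)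
have qp : a * adag * (adag * a) = adag * a by rewrite p_ar mulrA mpK.
have pq : adag * a * (a * adag) = a * adag by rewrite mulrA pa.
by rewrite -q_sa -pq starM q_sa p_sa.
Qed.

(** Left multiplication by [a] turns [adag * p = adag] into [q * p = q], whose
    adjoint is [p * q = q]; every step is reversible. *)
Lemma commutator_MP_proj_adag :
  ring_commutator (adag * a) adag = 0 <-> adag * a * a = a.
Proof.
rewrite /ring_commutator mpVK; split=> [/subr0_eq adag_p | pa].
  have qp : a * adag * (adag * a) = a * adag.
    by rewrite -mulrA -adag_p.
  have pq : adag * a * (a * adag) = a * adag.
    by have := congr1 star qp; rewrite starM q_sa p_sa.
  by rewrite -{2}mpK mulrA pq mpK.
have qp : a * adag * (adag * a) = a * adag.
  by rewrite -[LHS]starK starM q_sa p_sa mulrA pa q_sa.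
have -> : adag * (adag * a) = adag by rewrite -{1}mpVK -!mulrA !(mulrA a) qp mulrA mpVK.
by rewrite subrr.
Qed.

Lemma commutator_MP_proj :
  ring_commutator (adag * a) a = 0 <-> adag * a * a = a.
Proof.
rewrite /ring_commutator mulrA mpK.
by split=> [/subr0_eq | ->]; rewrite ?subrr.
Qed.

Lemma sub_right_ideal_MP_inverse :
  right_ideal a `<=` right_ideal adag <-> adag * a * a = a.
Proof.
rewrite sub_right_idealP; split=> [[r a_r] | pa].
  by rewrite {2}a_r mulrA mpVK.
by exists (a * a); rewrite mulrA.
Qed.

(** The adjoint of [a * p = a] is [p * a^* = a^*], and conversely
    [p = p^* = a^* * adag^*]; hence [a^* R = p R]. *)
Lemma sub_right_ideal_star :
  right_ideal a `<=` right_ideal (star a) <-> adag * a * a = a.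
Proof.
rewrite sub_right_idealP; split=> [[r a_r] | pa].
  have p_star : adag * a * star a = star a.
    by rewrite -p_sa -starM mulrA mpK.
  by rewrite {2}a_r mulrA p_star.
by exists (star adag * a); rewrite mulrA -starM p_sa.
Qed.

End MoorePenrose.

Theorem theorem4p9 (R : pzRingType) (star : R -> R)
    (star_inv : ring_involution star)
    (a adag : R) (a_MP : is_MP_inverse star a adag) :
  [<-> is_EP star a;
       right_ideal a = right_ideal (a ^+ 2) /\
         ring_commutator (adag * a) adag = 0;
       right_ideal a = right_ideal (a ^+ 2) /\
         ring_commutator (adag * a) a = 0;
       right_ideal a = right_ideal (a ^+ 2) /\
         right_ideal a `<=` right_ideal adag;
       right_ideal a = right_ideal (a ^+ 2) /\
         right_ideal a `<=` right_ideal (star a)].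
Proof.
have EP_P := iff_trans (is_EP_commuteP star_inv a_MP)
                       (commute_MP_inverseP star_inv a_MP).
have c2 := commutator_MP_proj_adag star_inv a_MP.
have c3 := commutator_MP_proj a_MP.
have c4 := sub_right_ideal_MP_inverse a_MP.
have c5 := sub_right_ideal_star star_inv a_MP.
by tfae; rewrite ?EP_P ?c2 ?c3 ?c4 ?c5.
Qed.
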